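(* Let $a\in\mathbb{I}_1\setminus F$. (1) $\mathrm{ind}_{K[x]}(a)=-\deg_{\partial^{-1}}(a+F)$, where $a+F\in\mathbb{I}_1/F=B_1$. (2) Let $i=\mathrm{ind}_{K[x]}(a)$. Then (a) $i\ge0$ iff $a=\partial^ia'$ for some element $a'\in\mathbb{I}_1\setminus F$ with $\mathrm{ind}_{K[x]}(a')=0$; (b) $i\le0$ iff $a=a'\int^{|i|}$ for some element $a'\in\mathbb{I}_1\setminus F$ with $\mathrm{ind}_{K[x]}(a')=0$. (3) Let $b\in\mathbb{I}_1\setminus F$ be such that $a+b\in\mathbb{I}_1\setminus F$. Then $\mathrm{ind}_{K[x]}(a+b)\ge\min\{\mathrm{ind}_{K[x]}(a),\mathrm{ind}_{K[x]}(b)\}$. Therefore, the index map $\mathrm{ind}_{K[x]}:\mathrm{Frac}(A_1)\to\mathbb{Z}\cup\{\infty\}$ is a discrete valuation. (4) $\mathrm{ind}_{K[x]}(\sigma(a))=\mathrm{ind}_{K[x]}(a)$ for all $K$-algebra automorphisms $\sigma$ of $\mathbb{I}_1$.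
   Context: $K$ is a field of characteristic zero. $\mathbb{I}_1$ is the subalgebra of $\mathrm{End}_K(K[x])$ generated by (multiplication by) $x$, $\partial=\frac{d}{dx}$ and $\int: x^n\mapsto \frac{x^{n+1}}{n+1}$; $A_1=K\langle x,\partial\rangle\subset\mathbb{I}_1$ is the first Weyl algebra. Put $H:=\partial x$, $e_{ij}:=\int^i\partial^j-\int^{i+1}\partial^{j+1}$ ($i,j\ge0$) and $F:=\bigoplus_{i,j\ge0}Ke_{ij}$, an ideal of $\mathbb{I}_1$. The factor algebra $\mathbb{I}_1/F$ is identified with $B_1:=K[H][\partial,\partial^{-1};\tau]$, $\tau(H)=H+1$, $\partial^{\pm1}\alpha=\tau^{\pm1}(\alpha)\partial^{\pm1}$ for $\alpha\in K[H]$, via $\partial\mapsto\partial$, $\int\mapsto\partial^{-1}$, $H\mapsto H$. $B_1$ is the localization of $A_1$ at the powers of $\partial$, so $\mathrm{Frac}(A_1)=\mathrm{Frac}(B_1)$ (skew field of fractions). A nonzero $u\in B_1$ is uniquely $u=\sum_{j=s}^d\alpha_j(\partial^{-1})^j$ with $\alpha_j\in K[H]$, $\alpha_d\neq0$ ($s\le d$ integers); $\deg_{\partial^{-1}}(u):=d$. For $a\in\mathbb{I}_1\setminus F$ the map $a_{K[x]}:K[x]\to K[x]$, $p\mapsto ap$, has finite dimensional kernel and cokernel, and $\mathrm{ind}_{K[x]}(a):=\dim_K\ker(a_{K[x]})-\dim_K\mathrm{coker}(a_{K[x]})$. It depends only on $a+F\in B_1\setminus\{0\}$, so one writes $\mathrm{ind}_{K[x]}(u)$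 for $0\ne u\in B_1$; it is extended to $\mathrm{Frac}(B_1)$ by $\mathrm{ind}_{K[x]}(s^{-1}u)=\mathrm{ind}_{K[x]}(u)-\mathrm{ind}_{K[x]}(s)$ for nonzero $s,u\in B_1$, and $\mathrm{ind}_{K[x]}(0)=\infty$. *)

(* Defs.v *)
From HB Require Import structures.
From mathcomp Require Import all_boot all_order all_algebra.
From mathcomp Require Import finmap boolp classical_sets.
From mathcomp.multinomials Require Import monalg.
From mathcomp Require Import zify.

Set Implicit Arguments.
Unset Strict Implicit.
Unset Printing Implicit Defensive.

Import Order.TTheory GRing.Theory Num.Theory.
Local Open Scope ring_scope.

Section GeneratedSubalgebra.
Variables (K : fieldType) (A : algType K) (G : set A).

(* the smallest K-subalgebra (containing 1) of A that contains G *)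
Definition gen_subalg : {pred A} :=
  [pred a | `[< forall T : {pred A}, GRing.subalg_closed T ->
                  (forall g, G g -> g \in T) -> a \in T >]].

Lemma gen_subalg_closed : GRing.subalg_closed gen_subalg.
Proof.
split.
- by apply/asboolP => T [T1].
- move=> c u v /asboolP hu /asboolP hv; apply/asboolP => T cT GT.
  by have [_ lT _] := cT; apply: lT; [apply: hu|apply: hv].
- move=> u v /asboolP hu /asboolP hv; apply/asboolP => T cT GT.
  by have [_ _ mT] := cT; apply: mT; [apply: hu|apply: hv].
Qed.

Lemma gen_subalg_sub g : G g -> g \in gen_subalg.
Proof. by move=> Gg; apply/asboolP => T _; apply. Qed.

End GeneratedSubalgebra.

Section PolyEnd.
Variable K : fieldType.

(* End_K(K[x]), with composition as product *)
Record polyEnd := PolyEnd {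
  polyEnd_fun :> {poly K} -> {poly K};
  polyEnd_linear : `[< linear polyEnd_fun >]
}.

Lemma polyEndP (f g : polyEnd) : f =1 g -> f = g.
Proof.
case: f g => f lf [g lg] /= /funext e; case: _ / e lg => lg.
by congr PolyEnd; exact: bool_irrelevance.
Qed.

Lemma polyEnd_islin (f : polyEnd) : linear f.
Proof. exact/asboolP/polyEnd_linear. Qed.

HB.instance Definition _ (f : polyEnd) :=
  GRing.isLinear.Build K {poly K} {poly K} *:%R f (polyEnd_islin f).

Definition mkEnd (f : {poly K} -> {poly K}) (lf : linear f) : polyEnd :=
  PolyEnd (asboolT lf).

Fact pe0_lin : linear (fun _ : {poly K} => 0 : {poly K}).
Proof. by move=> c p q; rewrite scaler0 addr0. Qed.
Fact peN_lin (f : polyEnd) : linear (fun p => - f p).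
Proof. by move=> c p q; rewrite linearP opprD scalerN. Qed.
Fact peD_lin (f g : polyEnd) : linear (fun p => f p + g p).
Proof. by move=> c p q; rewrite !linearP scalerDr addrACA. Qed.
Fact peZ_lin k (f : polyEnd) : linear (fun p => k *: f p).
Proof. by move=> c p q; rewrite linearP scalerDr !scalerA mulrC. Qed.
Fact pe1_lin : linear (fun p : {poly K} => p). Proof. by []. Qed.
Fact peM_lin (f g : polyEnd) : linear (fun p => f (g p)).
Proof. by move=> c p q; rewrite !linearP. Qed.

HB.instance Definition _ := gen_eqMixin polyEnd.
HB.instance Definition _ := gen_choiceMixin polyEnd.

Definition pe0 := mkEnd pe0_lin.
Definition peN f := mkEnd (peN_lin f).
Definition peD f g := mkEnd (peD_lin f g).
Definition peZ k f := mkEnd (peZ_lin k f).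
Definition pe1 := mkEnd pe1_lin.
Definition peM f g := mkEnd (peM_lin f g).

Fact peDA : associative peD.
Proof. by move=> f g h; apply: polyEndP => p /=; rewrite addrA. Qed.
Fact peDC : commutative peD.
Proof. by move=> f g; apply: polyEndP => p /=; rewrite addrC. Qed.
Fact pe0D : left_id pe0 peD.
Proof. by move=> f; apply: polyEndP => p /=; rewrite add0r. Qed.
Fact peND : left_inverse pe0 peN peD.
Proof. by move=> f; apply: polyEndP => p /=; rewrite addNr. Qed.
HB.instance Definition _ := GRing.isZmodule.Build polyEnd peDA peDC pe0D peND.

Fact peMA : associative peM.
Proof. by move=> f g h; apply: polyEndP. Qed.
Fact pe1M : left_id pe1 peM.
Proof. by move=> f; apply: polyEndP. Qed.
Fact peM1 : right_id pe1 peM.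
Proof. by move=> f; apply: polyEndP. Qed.
Fact peMDl : left_distributive peM +%R.
Proof. by move=> f g h; apply: polyEndP. Qed.
Fact peMDr : right_distributive peM +%R.
Proof. by move=> f g h; apply: polyEndP => p /=; rewrite linearD. Qed.
Fact pe1_neq0 : pe1 != 0 :> polyEnd.
Proof.
by apply/eqP => /(congr1 (fun f : polyEnd => f 1))/eqP; rewrite oner_eq0.
Qed.
HB.instance Definition _ := GRing.Zmodule_isNzRing.Build polyEnd
  peMA pe1M peM1 peMDl peMDr pe1_neq0.

Fact peZA c d f : peZ c (peZ d f) = peZ (c * d) f.
Proof. by apply: polyEndP => p /=; rewrite scalerA. Qed.
Fact peZ1 : left_id 1 peZ.
Proof. by move=> f; apply: polyEndP => p /=; rewrite scale1r. Qed.
Fact peZDr : right_distributive peZ +%R.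
Proof. by move=> c f g; apply: polyEndP => p /=; rewrite scalerDr. Qed.
Fact peZDl f : {morph peZ^~ f : c d / c + d}.
Proof. by move=> c d; apply: polyEndP => p /=; rewrite scalerDl. Qed.
HB.instance Definition _ := GRing.Zmodule_isLmodule.Build K polyEnd
  peZA peZ1 peZDr peZDl.
Fact peZAl c (f g : polyEnd) : c *: (f * g) = (c *: f) * g.
Proof. exact: polyEndP. Qed.
HB.instance Definition _ := GRing.Lmodule_isLalgebra.Build K polyEnd peZAl.
Fact peZAr c (f g : polyEnd) : c *: (f * g) = f * (c *: g).
Proof. by apply: polyEndP => p /=; rewrite linearZ. Qed.
HB.instance Definition _ := GRing.Lalgebra_isAlgebra.Build K polyEnd peZAr.

Lemma polyEndDE (f g : polyEnd) p : (f + g) p = f p + g p. Proof. by []. Qed.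
Lemma polyEndNE (f : polyEnd) p : (- f) p = - f p. Proof. by []. Qed.
Lemma polyEnd0E p : (0 : polyEnd) p = 0. Proof. by []. Qed.
Lemma polyEndME (f g : polyEnd) p : (f * g) p = f (g p). Proof. by []. Qed.
Lemma polyEnd1E p : (1 : polyEnd) p = p. Proof. by []. Qed.
Lemma polyEndZE c (f : polyEnd) p : (c *: f) p = c *: f p. Proof. by []. Qed.
Lemma polyEnd_sumE I (r : seq I) (P : pred I) (f : I -> polyEnd) p :
  (\sum_(i <- r | P i) f i) p = \sum_(i <- r | P i) f i p.
Proof. by elim/big_rec2: _ => [|i _ q _ <-]. Qed.

Fact mulX_lin : linear (fun p : {poly K} => 'X * p).
Proof. by move=> c p q; rewrite mulrDr scalerAr. Qed.
Definition mulX : polyEnd := mkEnd mulX_lin.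

Fact deriv_lin : linear (fun p : {poly K} => p^`()).
Proof. exact: linearP. Qed.
Definition derivX : polyEnd := mkEnd deriv_lin.

(* x^n |-> x^(n+1)/(n+1) *)
Definition int_poly (p : {poly K}) : {poly K} :=
  \sum_(i < size p) (p`_i / i.+1%:R) *: 'X^(i.+1).

Lemma coef_int_poly p i :
  (int_poly p)`_i = if i is j.+1 then p`_j / j.+1%:R else 0.
Proof.
rewrite coef_sum; case: i => [|j].
  by rewrite big1 // => i _; rewrite coefZ coefXn mulr0.
under eq_bigr do rewrite coefZ coefXn eqSS.
have [lt|le] := ltnP j (size p); last first.
  rewrite nth_default ?mul0r // big1 // => i _.
  by case: eqP => [E|_]; rewrite ?mulr0 //; move: (ltn_ord i); rewrite -E ltnNge le.
rewrite (bigD1 (Ordinal lt)) //= eqxx mulr1 big1 ?addr0 // => i ne.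
by rewrite (_ : (j == i) = false) ?mulr0 //; apply/negP => /eqP E; case/eqP: ne; apply/val_inj.
Qed.

Fact int_poly_lin : linear int_poly.
Proof.
move=> c p q; apply/polyP => i; rewrite coefD coefZ !coef_int_poly.
by case: i => [|i]; rewrite ?mulr0 ?addr0 // coefD coefZ mulrDl mulrA.
Qed.
Definition intX : polyEnd := mkEnd int_poly_lin.

Definition I1_gens : set polyEnd :=
  fun f => f = mulX \/ f = derivX \/ f = intX.

End PolyEnd.

Section I1.
Variable K : fieldType.

Record I1 := MkI1 {
  I1_val :> polyEnd K;
  I1_valP : I1_val \in gen_subalg (@I1_gens K)
}.
HB.instance Definition _ := [isSub for I1_val].
HB.instance Definition _ := [Choice of I1 by <:].
HB.instance Definition _ := GRing.SubChoice_isSubAlgebra.Build K (polyEnd K)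
  (gen_subalg (@I1_gens K)) I1
  (GRing.subalg_closed_semi (gen_subalg_closed (@I1_gens K))).

Definition I1x : I1 :=
  MkI1 (@gen_subalg_sub _ _ (@I1_gens K) _ (or_introl erefl)).
Definition I1d : I1 :=
  MkI1 (@gen_subalg_sub _ _ (@I1_gens K) _ (or_intror (or_introl erefl))).
Definition I1int : I1 :=
  MkI1 (@gen_subalg_sub _ _ (@I1_gens K) _ (or_intror (or_intror erefl))).

Definition I1H : I1 := I1d * I1x.
Definition I1e i j : I1 := I1int ^+ i * I1d ^+ j - I1int ^+ i.+1 * I1d ^+ j.+1.

Definition I1F : {pred I1} :=
  [pred a | `[< exists n (c : 'M[K]_n), a = \sum_i \sum_j c i j *: I1e i j >]].

(* the Weyl algebra K<x, d/dx> inside I1 *)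
Record A1 := MkA1 {
  A1_val :> I1;
  A1_valP : A1_val \in gen_subalg [set a : I1 | a = I1x \/ a = I1d]%classic
}.
HB.instance Definition _ := [isSub for A1_val].
HB.instance Definition _ := [Choice of A1 by <:].
HB.instance Definition _ := GRing.SubChoice_isSubAlgebra.Build K I1 _ A1
  (GRing.subalg_closed_semi (@gen_subalg_closed _ I1
     [set a : I1 | a = I1x \/ a = I1d]%classic)).

End I1.

Arguments I1F {K}.

Section Index.
Variable K : fieldType.

(* For subspaces W of U, the classes of the b i form a basis of U / W; no       *)
(* finiteness of V is assumed.                                                  *)
Definition quo_basis (V : lmodType K) (U W : set V) n (b : 'I_n -> V) : Prop :=
  [/\ forall i, U (b i),
      forall c : 'I_n -> K, W (\sum_i c i *: b i) -> forall i, c i = 0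
    & forall u, U u -> exists c : 'I_n -> K, W (u - \sum_i c i *: b i)].

(* dim (U / W) when it is finite, and 0 by convention otherwise; both           *)
(* dimensions in ind are finite when a is not in F.                             *)
Definition quo_dim (V : lmodType K) (U W : set V) : nat :=
  xget 0%N [set n | exists b : 'I_n -> V, quo_basis U W b]%classic.

Definition ind (a : I1 K) : int :=
  (quo_dim [set p | (a : polyEnd K) p = 0] [set 0])%classic%:Z
  - (quo_dim setT (range (a : polyEnd K)))%classic%:Z.

End Index.

Section B1.
Variable K : fieldType.

(* the k-th power of tau : H |-> H + 1; the variable of {poly K} stands for H *)
Definition tau (k : int) (p : {poly K}) : {poly K} := p \Po ('X + k%:~R%:P).

Fact tau_rmorph_proof k : zmod_morphism (tau k) * monoid_morphism (tau k).
Proof.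
split; first by move=> p q; rewrite /tau comp_polyB.
by split=> [|p q]; rewrite /tau ?comp_polyC // comp_polyM.
Qed.
HB.instance Definition _ k :=
  GRing.isZmodMorphism.Build {poly K} {poly K} (tau k) (tau_rmorph_proof k).1.
HB.instance Definition _ k :=
  GRing.isMonoidMorphism.Build {poly K} {poly K} (tau k) (tau_rmorph_proof k).2.

Lemma tau0 p : tau 0 p = p.
Proof. by rewrite /tau addr0 comp_polyXr. Qed.

Lemma tauD k l p : tau k (tau l p) = tau (k + l) p.
Proof.
rewrite /tau -comp_polyA comp_polyD comp_polyX comp_polyC -addrA -polyCD.
by rewrite intrD.
Qed.

Lemma tauC k c : tau k c%:P = c%:P.
Proof. by rewrite /tau comp_polyC. Qed.

Lemma horner_tau k p x : (tau k p).[x] = p.[x + k%:~R].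
Proof. by rewrite /tau horner_comp !hornerE. Qed.

(* K[H][d, d^-1; tau]: u is the finite sum of u@_k d^k, k ranging over int *)
Definition B1 := {malg {poly K}[int]}.
HB.instance Definition _ := GRing.Zmodule.on B1.

Implicit Types u v w : B1.

(* (p d^k) (q d^l) = p tau^k(q) d^(k+l) *)
Definition B1mul u v : B1 := \sum_(k <- msupp u) \sum_(l <- msupp v)
  << u@_k * tau k v@_l *g k + l >>.

Lemma B1mulw (d1 d2 : {fset int}) u v :
  (msupp u `<=` d1)%fset -> (msupp v `<=` d2)%fset ->
  B1mul u v = \sum_(k <- d1) \sum_(l <- d2) << u@_k * tau k v@_l *g k + l >>.
Proof.
move=> le1 le2; rewrite /B1mul (big_fset_incl _ le1) /=.
  apply/eq_bigr=> k _; apply/big_fset_incl => // l _ /mcoeff_outdom ->.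
  by rewrite rmorph0 mulr0 monalgU0.
move=> k _ /mcoeff_outdom uk.
by rewrite big1 // => l _; rewrite uk mul0r monalgU0.
Qed.

Lemma B1mulUU c1 c2 k1 k2 :
  B1mul << c1 *g k1 >> << c2 *g k2 >> = << c1 * tau k1 c2 *g k1 + k2 >>.
Proof. by rewrite (B1mulw msuppU_le msuppU_le) !big_seq_fset1 !mcoeffUU. Qed.

Lemma B1mulDl : left_distributive B1mul +%R.
Proof.
move=> u v w.
have le : (msupp w `<=` msupp w)%fset by apply: fsubset_refl.
rewrite (B1mulw (msuppD_le u v) le).
rewrite (B1mulw (fsubsetUl (msupp u) (msupp v)) le).
rewrite (B1mulw (fsubsetUr (msupp u) (msupp v)) le).
rewrite -big_split /=; apply/eq_bigr=> k _.
rewrite -big_split /=; apply/eq_bigr=> l _.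
by rewrite mcoeffD mulrDl monalgUD.
Qed.

Lemma B1mulDr : right_distributive B1mul +%R.
Proof.
move=> w u v.
have le : (msupp w `<=` msupp w)%fset by apply: fsubset_refl.
rewrite (B1mulw le (msuppD_le u v)).
rewrite (B1mulw le (fsubsetUl (msupp u) (msupp v))).
rewrite (B1mulw le (fsubsetUr (msupp u) (msupp v))).
rewrite -big_split /=; apply/eq_bigr=> k _.
rewrite -big_split /=; apply/eq_bigr=> l _.
by rewrite mcoeffD rmorphD mulrDr monalgUD.
Qed.

Lemma B1mul0 u : B1mul u 0 = 0.
Proof. by apply: (addrI (B1mul u 0)); rewrite -B1mulDr !addr0. Qed.
Lemma B10mul u : B1mul 0 u = 0.
Proof. by apply: (addrI (B1mul 0 u)); rewrite -B1mulDl !addr0. Qed.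

Lemma B1_ind (P : B1 -> Prop) :
  P 0 -> (forall u v, P u -> P v -> P (u + v)) ->
  (forall c k, P << c *g k >>) -> forall u, P u.
Proof.
by move=> P0 PD PU u; rewrite [u]monalgE; elim/big_rec: _ => [|k v _]; auto.
Qed.

Lemma B1mulA : associative B1mul.
Proof.
move=> u v w; elim/B1_ind: u => [|u1 u2 h1 h2|c1 k1].
- by rewrite !B10mul.
- by rewrite !B1mulDl h1 h2.
elim/B1_ind: v => [|u1 u2 h1 h2|c2 k2].
- by rewrite B10mul B1mul0 B10mul.
- by rewrite B1mulDl !B1mulDr h1 h2 B1mulDl.
elim/B1_ind: w => [|u1 u2 h1 h2|c3 k3].
- by rewrite !B1mul0.
- by rewrite !B1mulDr h1 h2.
by rewrite !B1mulUU rmorphM /= tauD mulrA addrA.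
Qed.

Definition B1one : B1 := << 1 *g 0 >>.

Lemma B11mul : left_id B1one B1mul.
Proof.
elim/B1_ind => [|u v hu hv|c k]; first by rewrite B1mul0.
  by rewrite B1mulDr hu hv.
by rewrite B1mulUU mul1r tau0 add0r.
Qed.

Lemma B1mul1 : right_id B1one B1mul.
Proof.
elim/B1_ind => [|u v hu hv|c k]; first by rewrite B10mul.
  by rewrite B1mulDl hu hv.
by rewrite B1mulUU rmorph1 mulr1 addr0.
Qed.

Lemma B1one_neq0 : B1one != 0.
Proof. by rewrite monalgU_eq0 oner_eq0. Qed.

HB.instance Definition _ := GRing.Zmodule_isNzRing.Build B1
  B1mulA B11mul B1mul1 B1mulDl B1mulDr B1one_neq0.

Definition B1Z (c : K) u : B1 := (<< c%:P *g 0 >> : B1) * u.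

Fact B1ZA c d u : B1Z c (B1Z d u) = B1Z (c * d) u.
Proof. by rewrite /B1Z mulrA; congr (_ * _); rewrite [LHS]B1mulUU tauC polyCM. Qed.
Fact B1Z1 : left_id 1 B1Z. Proof. by move=> u; rewrite /B1Z mul1r. Qed.
Fact B1ZDr : right_distributive B1Z +%R.
Proof. by move=> c u v; rewrite /B1Z mulrDr. Qed.
Fact B1ZDl u : {morph B1Z^~ u : c d / c + d}.
Proof. by move=> c d; rewrite /B1Z polyCD monalgUD mulrDl. Qed.
HB.instance Definition _ := GRing.Zmodule_isLmodule.Build K B1
  B1ZA B1Z1 B1ZDr B1ZDl.
Fact B1ZAl c u v : c *: (u * v) = (c *: u) * v :> B1.
Proof. exact: mulrA. Qed.
HB.instance Definition _ := GRing.Lmodule_isLalgebra.Build K B1 B1ZAl.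
Fact B1ZAr c u v : c *: (u * v) = u * (c *: v) :> B1.
Proof.
rewrite [RHS]mulrA [LHS]mulrA; congr (_ * _).
elim/B1_ind: u => [|u1 u2 h1 h2|d k]; first by rewrite mulr0 mul0r.
  by rewrite mulrDr mulrDl h1 h2.
rewrite [LHS]B1mulUU [RHS]B1mulUU tau0 tauC mulrC.
by rewrite addrC.
Qed.
HB.instance Definition _ := GRing.Lalgebra_isAlgebra.Build K B1 B1ZAr.

Lemma B1MUU c1 c2 k1 k2 : (<< c1 *g k1 >> : B1) * (<< c2 *g k2 >> : B1)
  = << c1 * tau k1 c2 *g k1 + k2 >>.
Proof. exact: B1mulUU. Qed.

Lemma B1ZU a c k : a *: (<< c *g k >> : B1) = << a%:P * c *g k >>.
Proof. by rewrite [LHS]B1mulUU tau0 add0r. Qed.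

Definition B1H : B1 := << 'X *g 0 >>.
Definition B1d (k : int) : B1 := << 1 *g k >>.

(* The coefficient of (d^-1)^j is u@_(- j); the value at u = 0 is 0 by         *)
(* convention.                                                                 *)
Definition deg_dinv u : int :=
  let s := [seq - k | k <- msupp u] in \big[Num.max/head 0 s]_(k <- s) k.

End B1.

Section Quotient.
Variable K : fieldType.

(* Lift to I1 of the normal form of u, with d^k lifted to the k-th power of d   *)
(* for k >= 0 and to the (-k)-th power of the integration operator for k < 0.   *)
Definition I1dpow (k : int) : I1 K :=
  match k with Posz n => I1d K ^+ n | Negz n => I1int K ^+ n.+1 end.

Definition B1lift (u : B1 K) : I1 K :=
  \sum_(k <- msupp u) horner_alg (I1H K) u@_k * I1dpow k.

(* The coset a + F as an element of B1.  The u chosen is unique (toB1_coset,    *)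
(* toB1_unique), and toB1 is a surjective algebra morphism with kernel F that  *)
(* maps the generators as prescribed (toB1_surj, toB1_eq0, toB1_d, toB1_int,    *)
(* toB1_H).                                                                    *)
Definition toB1 (K0 : [pchar K] =i pred0) (a : I1 K) : B1 K :=
  xget 0 [set u | a - B1lift u \in I1F]%classic.

Hypothesis K0 : [pchar K] =i pred0.

Let natK_neq0 n : n.+1%:R != 0 :> K.
Proof. by rewrite ((pcharf0P K).1 K0). Qed.
Let factK_neq0 n : n`!%:R != 0 :> K.
Proof. by rewrite -(prednK (fact_gt0 n)). Qed.

(* divided powers x^n/n!, extended by 0 to negative n *)
Definition dpow (k : int) : {poly K} :=
  if k is Posz n then n`!%:R^-1 *: 'X^n else 0.
Arguments dpow : simpl never.

Lemma dpowE (n : nat) : dpow n = n`!%:R^-1 *: 'X^n. Proof. by []. Qed.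
Lemma dpowN (n : nat) : dpow (Negz n) = 0. Proof. by []. Qed.

Lemma polyEnd_dpow (f g : polyEnd K) :
  (forall n : nat, f (dpow n) = g (dpow n)) -> f = g.
Proof.
move=> h; apply: polyEndP => p; rewrite -[p]coefK poly_def !linear_sum.
apply: eq_bigr => i _; rewrite !linearZ /=; congr (_ *: _).
have := h i; rewrite dpowE !linearZ /= => /(congr1 (fun q => i`!%:R *: q)).
by rewrite !scalerA divff ?scale1r.
Qed.

Lemma deriv_dpow (k : int) : derivX K (dpow k) = dpow (k - 1).
Proof.
case: k => [[|n]|n]; first by rewrite dpowE linearZ /= derivC scaler0.
  have -> : Posz n.+1 - 1 = Posz n by lia.
  rewrite !dpowE linearZ /= derivXn -scaler_nat scalerA factS natrM invfM.
  by rewrite mulrAC mulVf ?mul1r // natK_neq0.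
have -> : Negz n - 1 = Negz n.+1 by lia.
by rewrite !dpowN linear0.
Qed.

Lemma int_dpow (n : nat) : intX K (dpow n) = dpow (Posz n + 1).
Proof.
rewrite (_ : Posz n + 1 = Posz n.+1); last by lia.
apply/polyP => i; rewrite coef_int_poly !dpowE; case: i => [|i].
  by rewrite coefZ coefXn mulr0.
rewrite !coefZ !coefXn eqSS; case: eqP => [->|_]; last by rewrite !mulr0 mul0r.
by rewrite !mulr1 factS natrM invfM mulrC.
Qed.

Lemma mulX_dpow (n : nat) : mulX K (dpow n) = (n.+1)%:R *: dpow (Posz n + 1).
Proof.
rewrite (_ : Posz n + 1 = Posz n.+1); last by lia.
rewrite !dpowE /= -scalerAr -exprS scalerA factS natrM invfM mulrA divff ?mul1r //.
Qed.

Lemma derivX_dpow (n : nat) (k : int) :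
  (derivX K ^+ n) (dpow k) = dpow (k - n%:Z).
Proof.
elim: n k => [|n IH] k; first by rewrite expr0 subr0.
by rewrite exprS polyEndME IH deriv_dpow; congr dpow; lia.
Qed.

Lemma intX_dpow (n m : nat) : (intX K ^+ n) (dpow m) = dpow (m%:Z + n%:Z).
Proof.
elim: n m => [|n IH] k; first by rewrite expr0 addr0.
rewrite exprSr polyEndME int_dpow (_ : Posz k + 1 = Posz k.+1); last by lia.
by rewrite IH; congr dpow; lia.
Qed.

Lemma valX (a : I1 K) n : \val (a ^+ n) = \val a ^+ n.
Proof. exact: rmorphXn. Qed.

Lemma I1dpow_dpow k (n : nat) : \val (I1dpow k) (dpow n) = dpow (n%:Z - k).
Proof.
case: k => m; rewrite /I1dpow valX; first by rewrite derivX_dpow.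
by rewrite intX_dpow NegzE opprK.
Qed.

Lemma H_dpow (k : int) : \val (I1H K) (dpow k) = (k + 1)%:~R *: dpow k.
Proof.
case: k => [n|n]; last by rewrite dpowN !linear0.
rewrite [LHS](_ : _ = derivX K (mulX K (dpow n))) // mulX_dpow linearZ.
rewrite [X in _ *: X = _]deriv_dpow addrK; congr (_ *: _).
by rewrite intrD -addn1 natrD.
Qed.

Lemma alg_eval_dpow (p : {poly K}) (k : int) :
  \val (horner_alg (I1H K) p) (dpow k) = p.[(k + 1)%:~R] *: dpow k.
Proof.
elim/poly_ind: p => [|p c IH].
  by rewrite rmorph0 horner0 scale0r.
rewrite rmorphD rmorphM /= horner_algX horner_algC.
rewrite [LHS](_ : _ = \val (horner_alg (I1H K) p) (\val (I1H K) (dpow k)) + c *: dpow k) //.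
rewrite H_dpow [X in X + _ = _]linearZ /=.
by rewrite IH !hornerE scalerA -scalerDl mulrC.
Qed.

Definition B1act (u : B1 K) (n : int) : {poly K} :=
  \sum_(k <- msupp u) (u@_k).[(n - k + 1)%:~R] *: dpow (n - k).

Lemma B1actw (d : {fset int}) u n : (msupp u `<=` d)%fset ->
  B1act u n = \sum_(k <- d) (u@_k).[(n - k + 1)%:~R] *: dpow (n - k).
Proof.
move=> le; rewrite /B1act (big_fset_incl _ le) //=.
by move=> k _ /mcoeff_outdom ->; rewrite horner0 scale0r.
Qed.

Lemma B1actD u v n : B1act (u + v) n = B1act u n + B1act v n.
Proof.
rewrite (B1actw n (msuppD_le u v)) (B1actw n (fsubsetUl _ (msupp v))).
rewrite (B1actw n (fsubsetUr (msupp u) _)) -big_split /=.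
by apply: eq_bigr => k _; rewrite mcoeffD hornerD scalerDl.
Qed.

Lemma B1actU c k n :
  B1act << c *g k >> n = c.[(n - k + 1)%:~R] *: dpow (n - k).
Proof. by rewrite (B1actw _ msuppU_le) big_seq_fset1 mcoeffUU. Qed.

Lemma B1act0 n : B1act 0 n = 0.
Proof. by rewrite /B1act msupp0 big_seq_fset0. Qed.

Lemma B1lift_dpow u (n : nat) : \val (B1lift u) (dpow n) = B1act u n.
Proof.
rewrite /B1lift rmorph_sum /= polyEnd_sumE; apply: eq_bigr => k _.
by rewrite [LHS]polyEndME I1dpow_dpow alg_eval_dpow.
Qed.

Lemma I1e_dpow i j (n : nat) :
  \val (I1e K i j) (dpow n) = if n == j then dpow i else 0.
Proof.
rewrite /I1e rmorphB !rmorphM !rmorphXn /=.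
rewrite !derivX_dpow; have [lt|gt|->] := ltngtP n j.
- rewrite (_ : Posz n - j%:Z = Negz (j - n).-1); last by lia.
  rewrite (_ : Posz n - j.+1%:Z = Negz (j - n)); last by lia.
  by rewrite !dpowN !linear0 addr0.
- rewrite (_ : Posz n - j%:Z = Posz (n - j)%N); last by lia.
  rewrite (_ : Posz n - j.+1%:Z = Posz (n - j.+1)%N); last by lia.
  rewrite !intX_dpow (_ : (n - j)%N%:Z + i%:Z = (n - j.+1)%N%:Z + i.+1%:Z) ?subrr //.
  lia.
- rewrite subrr (_ : Posz j - j.+1%:Z = Negz 0); last by lia.
  by rewrite (intX_dpow i 0) dpowN !linear0 addr0 add0r.
Qed.

Lemma I1F_dpowP (a : I1 K) :
  reflect (exists N : nat, forall n : nat, (N <= n)%N -> \val a (dpow n) = 0)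
          (a \in I1F).
Proof.
apply: (iffP (asboolP _)) => [[n [c ->]]|[N hN]].
  exists n => m le; rewrite rmorph_sum polyEnd_sumE big1 // => i _.
  rewrite rmorph_sum polyEnd_sumE big1 // => j _.
  rewrite [LHS](_ : _ = c i j *: \val (I1e K i j) (dpow m)) //.
  by rewrite I1e_dpow gtn_eqF ?scaler0 // (leq_trans _ le).
pose M := maxn N (\max_(j < N) size (\val a (dpow j))).
exists M, (\matrix_(i, j) ((\val a (dpow j))`_i * i`!%:R)).
apply/val_inj/polyEnd_dpow => n.
rewrite rmorph_sum polyEnd_sumE.
transitivity (\sum_(i < M) \sum_(j < M)
    ((\val a (dpow j))`_i * i`!%:R) *: (if n == j then dpow i else 0)); last first.
  apply: eq_bigr => i _; rewrite rmorph_sum polyEnd_sumE; apply: eq_bigr => j _.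
  by rewrite mxE -I1e_dpow.
have [ltN|geN] := ltnP n N; last first.
  rewrite hN // big1 // => i _; rewrite big1 // => j _.
  case: eqP => [<-|_]; last by rewrite scaler0.
  by rewrite hN // coef0 mul0r scale0r.
have nM : (n < M)%N by rewrite (leq_trans ltN) // leq_maxl.
have sM : (size (\val a (dpow n)) <= M)%N.
  rewrite leq_max; apply/orP; right.
  exact: (leq_bigmax (F := fun j : 'I_N => size (\val a (dpow j))) (Ordinal ltN)).
rewrite -[LHS]coefK poly_def (big_ord_widen M (fun i => (\val a (dpow n))`_i *: 'X^i)) //.
rewrite big_mkcond /=; apply: eq_bigr => i _.
rewrite (bigD1 (Ordinal nM)) //= eqxx big1 ?addr0; last first.
  move=> j ne; case: eqP => [E|_]; last by rewrite scaler0.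
  by case/eqP: ne; apply/val_inj.
rewrite scalerA -mulrA divff // mulr1.
by case: ltnP => // le; rewrite nth_default ?scale0r.
Qed.

(* f agrees with u on x^n for n large *)
Definition asym (f : polyEnd K) (u : B1 K) : Prop :=
  exists N : nat, forall n : nat, (N <= n)%N -> f (dpow n) = B1act u n.

Lemma asymP (a : I1 K) u : a - B1lift u \in I1F <-> asym (\val a) u.
Proof.
split=> [/I1F_dpowP [N h]|[N h]].
  exists N => n /h; rewrite rmorphB polyEndDE polyEndNE B1lift_dpow.
  by move/eqP; rewrite subr_eq0 => /eqP.
apply/I1F_dpowP; exists N => n /h e.
by rewrite rmorphB polyEndDE polyEndNE B1lift_dpow e subrr.
Qed.

Lemma asymD f g u v : asym f u -> asym g v -> asym (f + g) (u + v).
Proof.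
move=> [N h] [M h']; exists (maxn N M) => n; rewrite geq_max => /andP [le le'].
by rewrite polyEndDE h // h' // B1actD.
Qed.

Lemma asym_sum (I : Type) (r : seq I) (F : I -> polyEnd K) (G : I -> B1 K) :
  (forall i, asym (F i) (G i)) -> asym (\sum_(i <- r) F i) (\sum_(i <- r) G i).
Proof.
move=> h; elim/big_ind2: _ => [|f u g v|//]; last exact: asymD.
by exists 0%N => n _; rewrite B1act0.
Qed.

Lemma asymZ c f u : asym f u -> asym (c *: f) (c *: u).
Proof.
move=> [N h]; exists N => n le; rewrite polyEndZE h //.
elim/B1_ind: u {h} => [|u v hu hv|d k].
- by rewrite scaler0 !B1act0 scaler0.
- by rewrite scalerDr !B1actD scalerDr hu hv.
- by rewrite B1ZU !B1actU scalerA hornerM hornerC.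
Qed.

Lemma B1act_mulU u c k (n : int) :
  B1act (u * (<< c *g k >> : B1 K)) n = c.[(n - k + 1)%:~R] *: B1act u (n - k).
Proof.
elim/B1_ind: u => [|u v hu hv|d l].
- by rewrite mul0r !B1act0 scaler0.
- by rewrite mulrDl !B1actD scalerDr hu hv.
rewrite B1MUU !B1actU scalerA hornerM horner_tau -intrD mulrC.
have -> : n - (l + k) = n - k - l by lia.
by have -> : n - k - l + 1 + l = n - k + 1 by lia.
Qed.

Lemma asymM f g u v : asym f u -> asym g v -> asym (f * g) (u * v).
Proof.
move=> [N h] [M h'].
exists (maxn M (N + \sum_(k <- msupp v) `|k|)%N) => n.
rewrite geq_max => /andP [leM leN].
rewrite polyEndME h' // /B1act linear_sum.
rewrite [in RHS](monalgE v) mulr_sumr.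
rewrite -[RHS]/(B1act _ n).
have B1act_sum (r : seq int) (F : int -> B1 K) :
    B1act (\sum_(i <- r) F i) n = \sum_(i <- r) B1act (F i) n.
  by elim/big_rec2: _ => [|i y z _ <-]; rewrite ?B1act0 ?B1actD.
rewrite B1act_sum big_seq [RHS]big_seq; apply: eq_bigr => k kv.
rewrite B1act_mulU linearZ /=; congr (_ *: _).
have le : (`|k| <= \sum_(k <- msupp v) `|k|)%N.
  by rewrite (big_fsetD1 k) //= leq_addr.
have -> : n%:Z - k = `|n%:Z - k|%N by lia.
by apply: h; lia.
Qed.

Lemma asym1 : asym 1 1.
Proof.
exists 0%N => n _; rewrite [RHS](B1actU 1 0 n) hornerC scale1r.
by rewrite subr0.
Qed.

Lemma asym_x : asym (mulX K) << 'X - 1 *g -1 >>.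
Proof.
exists 0%N => n _; rewrite mulX_dpow B1actU !hornerE opprK.
by congr (_ *: _); rewrite !intrD addrK -addn1 natrD.
Qed.
Lemma asym_d : asym (derivX K) (B1d K 1).
Proof. by exists 0%N => n _; rewrite deriv_dpow B1actU hornerC scale1r. Qed.
Lemma asym_int : asym (intX K) (B1d K (-1)).
Proof. by exists 0%N => n _; rewrite int_dpow B1actU hornerC scale1r opprK. Qed.

Lemma asym_exists (a : I1 K) : exists u, asym (\val a) u.
Proof.
have /asboolP/(_ [pred f | `[< exists u, asym f u >]]) h := I1_valP a.
apply/asboolP/h => [|f]; last first.
  by case=> [->|[->|->]]; apply/asboolP; [exists << 'X - 1 *g -1 >>; exact: asym_x
    |exists (B1d K 1); exact: asym_d|exists (B1d K (-1)); exact: asym_int].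
split; first by apply/asboolP; exists 1; exact: asym1.
  move=> c f g /asboolP [u hu] /asboolP [v hv]; apply/asboolP.
  by exists (c *: u + v); apply: asymD => //; apply: asymZ.
move=> f g /asboolP [u hu] /asboolP [v hv]; apply/asboolP.
by exists (u * v); apply: asymM.
Qed.

Lemma asym0_eq0 u : asym 0 u -> u = 0.
Proof.
move=> [N h]; apply/malgP => k; rewrite mcoeff0.
pose M := (N + `|k|)%N.
have vanish (n : nat) : (M <= n)%N -> (u@_k).[(n%:Z - k + 1)%:~R] = 0.
  move=> le; have /h : (N <= n)%N by rewrite (leq_trans _ le) ?leq_addr.
  have E : n%:Z - k = `|n%:Z - k|%N by rewrite /M in le; lia.
  rewrite /B1act => /(congr1 (fun p : {poly K} => p`_(`|n%:Z - k|%N))).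
  rewrite coef0 coef_sum => /esym.
  have [kin|/mcoeff_outdom -> _] := boolP (k \in msupp u); last by rewrite horner0.
  rewrite (big_fsetD1 k) //= [X in _ + X]big_seq [X in _ + X]big1 ?addr0; last first.
    move=> l; rewrite in_fsetD1 => /andP [ne _]; rewrite coefZ.
    case F: (n%:Z - l) => [m|m]; last by rewrite dpowN coef0 mulr0.
    rewrite dpowE coefZ coefXn; case: eqP => [e|_]; last by rewrite !mulr0.
    by case/eqP: ne; lia.
  rewrite {2}E coefZ dpowE coefZ coefXn eqxx mulr1.
  by move/eqP; rewrite mulf_eq0 invr_eq0 (negbTE (factK_neq0 _)) orbF => /eqP.
apply/eqP/negPn/negP => nz.
pose s := [seq ((M + i)%:Z - k + 1)%:~R : K | i <- iota 0 (size u@_k)].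
have := max_poly_roots (rs := s) nz; rewrite size_map size_iota ltnn => h'.
suff : false by []. apply: h'.
  apply/allP => x /mapP [i _ ->]; rewrite /root vanish ?leq_addr //.
rewrite map_inj_uniq ?iota_uniq // => i j /eqP.
rewrite -subr_eq0 -intrB.
have -> : (M + i)%:Z - k + 1 - ((M + j)%:Z - k + 1) = i%:Z - j%:Z by lia.
rewrite intrB subr_eq0; move/eqP => e.
have nat_inj (m l : nat) : (m < l)%N -> m%:R != l%:R :> K.
  move=> lt; rewrite eq_sym -subr_eq0 -natrB ?(ltnW lt) //.
  by rewrite -(prednK (_ : 0 < l - m)%N) ?subn_gt0.
by have [/nat_inj/eqP|/nat_inj/eqP/nesym|->] := ltngtP i j.
Qed.

Lemma asym_uniq f u v : asym f u -> asym f v -> u = v.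
Proof.
move=> hu /(asymZ (-1)) hv; have := asymD hu hv.
rewrite !scaleN1r subrr => /asym0_eq0 /eqP.
by rewrite subr_eq0 => /eqP.
Qed.

Lemma toB1P (a : I1 K) : asym (\val a) (toB1 K0 a).
Proof.
rewrite /toB1; case: xgetP => [u _ /asymP //|h].
by have [u /asymP/h] := asym_exists a.
Qed.

Lemma toB1E (a : I1 K) u : asym (\val a) u -> toB1 K0 a = u.
Proof. exact/asym_uniq/toB1P. Qed.

Lemma toB1_coset a : a - B1lift (toB1 K0 a) \in I1F.
Proof. exact/asymP/toB1P. Qed.

Lemma toB1_unique a u : a - B1lift u \in I1F -> toB1 K0 a = u.
Proof. by move/asymP/toB1E. Qed.

Lemma toB1_eq0 a : (toB1 K0 a == 0) = (a \in I1F).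
Proof.
apply/eqP/idP => [e|aF]; last first.
  by apply: toB1_unique; rewrite /B1lift msupp0 big_seq_fset0 subr0.
by have := toB1_coset a; rewrite e /B1lift msupp0 big_seq_fset0 subr0.
Qed.

Lemma toB1_d : toB1 K0 (I1d K) = B1d K 1.
Proof. exact/toB1E/asym_d. Qed.
Lemma toB1_int : toB1 K0 (I1int K) = B1d K (-1).
Proof. exact/toB1E/asym_int. Qed.
Lemma toB1_H : toB1 K0 (I1H K) = B1H K.
Proof.
apply: toB1E; exists 0%N => n _.
by rewrite H_dpow [RHS]B1actU hornerX subr0.
Qed.

Lemma toB1_surj u : exists a, toB1 K0 a = u.
Proof.
exists (B1lift u); apply: toB1_unique; rewrite subrr.
by apply/I1F_dpowP; exists 0%N.
Qed.

Fact toB1_zmod_morphism : zmod_morphism (toB1 K0).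
Proof.
move=> a b; apply: toB1E; rewrite -(scaleN1r (toB1 K0 b)).
have -> : \val (a - b) = \val a + (-1) *: \val b.
  by rewrite rmorphB scaleN1r.
by apply: asymD; [|apply: asymZ]; apply: toB1P.
Qed.

Fact toB1_monoid_morphism : monoid_morphism (toB1 K0).
Proof.
split; first exact/toB1E/asym1.
by move=> a b; apply: toB1E; apply: asymM; apply: toB1P.
Qed.

Fact toB1_scalable : scalable (toB1 K0).
Proof. by move=> c a; apply: toB1E; apply: asymZ; apply: toB1P. Qed.

End Quotient.

HB.instance Definition _ (K : fieldType) (K0 : [pchar K] =i pred0) := GRing.isZmodMorphism.Build (I1 K) (B1 K)
  (@toB1 K K0) (toB1_zmod_morphism K0).
HB.instance Definition _ (K : fieldType) (K0 : [pchar K] =i pred0) := GRing.isMonoidMorphism.Build (I1 K) (B1 K)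
  (@toB1 K K0) (toB1_monoid_morphism K0).
HB.instance Definition _ (K : fieldType) (K0 : [pchar K] =i pred0) := GRing.isScalable.Build K (I1 K) (B1 K) *:%R
  (@toB1 K K0) (toB1_scalable K0).

(* D is a skew field, and its elements are the left fractions s^-1 u over R *)
Definition is_skew_field_of_fractions (R : nzRingType) (D : unitRingType)
    (f : {rmorphism R -> D}) : Prop :=
  [/\ forall q : D, q != 0 -> q \is a GRing.unit,
      injective f
    & forall q : D, exists s u : R, s != 0 /\ q = (f s)^-1 * f u].

(* Z together with infinity, represented by None *)
Definition Zinf := option int.

Definition addZinf (x y : Zinf) : Zinf :=
  if x is Some m then if y is Some n then Some (m + n) else None else None.

Definition leZinf (x y : Zinf) : bool :=
  if y is Some n then if x is Some m then m <= n else false else true.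

Definition minZinf (x y : Zinf) : Zinf := if leZinf x y then x else y.

(* discrete: the value group is all of Z *)
Definition discrete_valuation (D : nzRingType) (v : D -> Zinf) : Prop :=
  [/\ forall q, v q = None <-> q = 0,
      forall p q, v (p * q) = addZinf (v p) (v q),
      forall p q, leZinf (minZinf (v p) (v q)) (v (p + q))
    & forall n : int, exists q, v q = Some n].

(* v is the extension of the index to a ring D containing B_1; it is uniquely   *)
(* determined when every element of D is a left fraction of elements of B_1.    *)
Definition is_index_extension (K : fieldType) (K0 : [pchar K] =i pred0)
    (D : unitRingType) (f : {rmorphism B1 K -> D}) (v : D -> Zinf) : Prop :=
  v 0 = None /\
  forall s u : I1 K, s \notin I1F -> u \notin I1F ->
    v ((f (toB1 K0 s))^-1 * f (toB1 K0 u)) = Some (ind u - ind s).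

(* Main.v *)
From mathcomp Require Import all_boot all_order all_algebra.
From mathcomp Require Import finmap boolp classical_sets.
From mathcomp.multinomials Require Import monalg.
From mathcomp Require Import zify.
Require Import Defs.

(** Outside F, every a in I_1 eventually shifts degrees by a constant: if
    a + F = sum_(j <= m) alpha_j (d^-1)^j with alpha_m nonzero, then for n large
    a maps x^n to a polynomial of degree exactly n + m, because alpha_m has
    finitely many roots among the integers (asym_shifts).  An endomorphism f of
    K[x] with this property is, for suitable M and M' = M + m, a map from the
    polynomials of size at most M to those of size at most M', and a triangular
    isomorphism beyond; rank-nullity for the finite block gives index
    M - M' = - m (window_index, ind_shifts).  This is the formula for the index.

    The shift constant is visibly additive under composition, and that of a sum
    is at most the maximum of the two.  Together with the formula for the index
    this makes the index a valuation on I_1 \ F (indM, ind_add_ge) without any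
    computation in B_1.  Since d int = 1, the factorizations are
    a = d^n (int^n a) and a = (a d^n) int^n.

    A valuation on a domain extends to its skew field of left fractions
    (fraction_valuation_discrete).  The skew field of A_1 is one for B_1 as well,
    as d^n u lies in the image of A_1 for every u in B_1 and n large
    (weyl_localization).

    Finally, an automorphism sigma twists K[x] into an isomorphic module: K[x] is
    generated by 1, whose annihilator is the annihilator of e_00, so any nonzero
    vector p in the image of the idempotent sigma(e_00) gives an isomorphism
    a 1 |-> sigma(a) p (automorphism_intertwiner).  It carries the kernel and the
    image of a to those of sigma(a). *)

Set Implicit Arguments.
Unset Strict Implicit.
Unset Printing Implicit Defensive.

Import Order.TTheory GRing.Theory Num.Theory.
Local Open Scope ring_scope.

(** * Dimension of a quotient of subspaces *)

Section QuotientDimension.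
Variables (K : fieldType) (V : lmodType K).
Implicit Types U W : set V.

Definition lin_closed W := W 0 /\ forall c x y, W x -> W y -> W (c *: x + y).

(** The matrix expressing one basis through the other, modulo W, has
    independent rows. *)
Lemma quo_basis_leq U W n m (b : 'I_n -> V) (b' : 'I_m -> V) :
  lin_closed W -> quo_basis U W b -> quo_basis U W b' -> (n <= m)%N.
Proof.
move=> [W0 Wlin] [Ub freeb _] [_ _ span'].
have [c hc] := fin_all_exists (fun i => span' _ (Ub i)).
pose C := \matrix_(i, j) c i j.
suff /eqP <- : row_free C by exact: rank_leq_col.
apply: inj_row_free => v vC; apply/rowP => i; rewrite mxE.
apply: (freeb (v 0)).
have Wsum (r : seq 'I_n) : W (\sum_(i <- r) v 0 i *: (b i - \sum_j c i j *: b' j)).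
  by elim: r => [|k r IH]; rewrite ?big_nil // big_cons; apply: Wlin.
have := Wsum (index_enum _); congr W.
under eq_bigr do rewrite scalerBr.
rewrite sumrB [X in _ - X](_ : _ = 0) ?subr0 //.
under eq_bigr do rewrite scaler_sumr.
rewrite exchange_big big1 // => j _.
under eq_bigr do rewrite scalerA.
rewrite -scaler_suml; move/rowP: vC => /(_ j); rewrite !mxE => e.
by rewrite [X in X *: _](_ : _ = 0) ?scale0r // -[RHS]e; apply: eq_bigr => k _; rewrite mxE.
Qed.

Lemma quo_dimE U W n (b : 'I_n -> V) :
  lin_closed W -> quo_basis U W b -> quo_dim U W = n.
Proof.
move=> Wl hb; rewrite /quo_dim; case: xgetP => [m _ [b' hb']|h].
  by apply/eqP; rewrite eqn_leq !(quo_basis_leq Wl hb hb', quo_basis_leq Wl hb' hb).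
by case: (h n); exists b.
Qed.

End QuotientDimension.

(** * Transport of quotient dimensions along a surjection *)

Section Transport.
Variables (K : fieldType) (V V' : lmodType K) (phi : {linear V -> V'}).
Variables (U W : set V) (U' W' : set V').
Hypothesis phi_surj : forall y, exists x, phi x = y.
Hypothesis UE : forall x, U x <-> U' (phi x).
Hypothesis WE : forall x, W x <-> W' (phi x).

Lemma quo_basis_transport n (b : 'I_n -> V) :
  quo_basis U W b <-> quo_basis U' W' (phi \o b).
Proof.
have sumE c : \sum_i c i *: (phi \o b) i = phi (\sum_i c i *: b i).
  by rewrite linear_sum; apply: eq_bigr => i _; rewrite linearZ.
split=> -[Ub free span]; split.
- by move=> i; apply/UE.
- by move=> c; rewrite sumE => /WE; exact: free.
- move=> y; have [x <-] := phi_surj y => /UE /span [c Wc]; exists c.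
  by rewrite sumE -linearB; exact/WE.
- by move=> i; apply/UE; apply: Ub.
- by move=> c /WE; rewrite -sumE; exact: free.
- move=> x /UE /span [c Wc]; exists c; apply/WE.
  by rewrite linearB -sumE.
Qed.

Lemma quo_dim_transport : quo_dim U W = quo_dim U' W'.
Proof.
congr xget; apply/funext => n; apply/propext; split=> -[b].
  by move=> /quo_basis_transport ?; exists (phi \o b).
have [b' b'E] := fin_all_exists (fun i => phi_surj (b i)).
move=> hb; exists b'; apply/quo_basis_transport.
by rewrite (_ : phi \o b' = b) //; apply/funext => i; exact: b'E.
Qed.

End Transport.

(** * Endomorphisms of K[x] that eventually shift the degree *)

Section Shifts.
Variable K : fieldType.
Implicit Types (f g h : polyEnd K) (d e : int) (p q : {poly K}).

Definition shifts f d :=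
  exists M : nat, forall p : {poly K}, (M < size p)%N -> (size (f p))%:Z = (size p)%:Z + d.

Lemma size_bounded f N : exists B, forall p, (size p <= N)%N -> (size (f p) <= B)%N.
Proof.
exists (\max_(i < N) size (f 'X^i)) => p le.
rewrite -[p]coefK poly_def linear_sum; apply: (leq_trans (size_sum _ _ _)).
apply/bigmax_leqP => i _; rewrite linearZ; apply: (leq_trans (size_scale_leq _ _)).
exact: (leq_bigmax (F := fun j : 'I_N => size (f 'X^j)) (Ordinal (leq_trans (ltn_ord i) le))).
Qed.

Lemma shifts_uniq f d d' : shifts f d -> shifts f d' -> d = d'.
Proof.
move=> [M h] [M' h']; pose p : {poly K} := 'X^(maxn M M').
have sp : size p = (maxn M M').+1 by rewrite size_polyXn.
have := h p; have := h' p; rewrite sp !ltnS leq_maxl leq_maxr => /(_ isT) -> /(_ isT).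
by move/addrI.
Qed.

Lemma shifts_comp f g d e : shifts f d -> shifts g e -> shifts (f * g) (d + e).
Proof.
move=> [M h] [N h']; exists (maxn N (M + `|e|)%N) => p; rewrite gtn_max => /andP [lN lM].
by have e' := h' p lN; rewrite polyEndME h; lia.
Qed.

Lemma shifts_add_le f g h d e k : shifts f d -> shifts g e -> shifts h k ->
  h = f + g -> k <= Num.max d e.
Proof.
move=> [M hf] [N hg] [L hh] E; pose n := maxn M (maxn N L).
pose p : {poly K} := 'X^n.
have sp : size p = n.+1 by rewrite size_polyXn.
have [lM lN lL] : [/\ (M < size p)%N, (N < size p)%N & (L < size p)%N].
  by rewrite sp /n; split; lia.
have := size_polyD (f p) (g p); rewrite -polyEndDE -E.
move: (hf p lM) (hg p lN) (hh p lL); rewrite le_max; lia.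
Qed.

(** Beyond a bound that also dominates the images of the finitely many x^i with
    i < N, the leading monomial of p determines the size of f p. *)
Lemma shifts_of_Xn f d N :
  (forall n, (N <= n)%N -> (size (f 'X^n))%:Z = n.+1%:Z + d) -> shifts f d.
Proof.
move=> h; have [B hB] := size_bounded f N.
pose M := (N + B + `|d|)%N.
have low n p : (M <= n)%N -> (size p <= n)%N -> (size (f p) <= `|(n%:Z + d)%R|)%N.
  move=> lM le; rewrite -[p]coefK poly_def linear_sum.
  apply: (leq_trans (size_sum _ _ _)); apply/bigmax_leqP => i _; rewrite linearZ.
  apply: (leq_trans (size_scale_leq _ _)).
  have [lt|ge] := ltnP i N.
    apply: (leq_trans (hB _ _)); first by rewrite size_polyXn.
    by rewrite /M in lM; lia.
  by move: (h i ge) (leq_trans (ltn_ord i) le) => /=; lia.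
exists M => p lt; have [n sp] : exists n, size p = n.+1.
  by exists (size p).-1; rewrite prednK // (leq_ltn_trans _ lt).
rewrite sp ltnS in lt.
have pE : p = p`_n *: 'X^n + (p - p`_n *: 'X^n) by rewrite addrC subrK.
have lc : p`_n != 0.
  have : lead_coef p != 0 by rewrite lead_coef_eq0 -size_poly_eq0 sp.
  by rewrite lead_coefE sp.
have sr : (size (p - p`_n *: 'X^n)%R <= n)%N.
  apply/leq_sizeP => j; rewrite leq_eqVlt coefB coefZ coefXn => /orP [/eqP <-|lt'].
    by rewrite eqxx mulr1 subrr.
  by rewrite gtn_eqF // mulr0 subr0 nth_default // sp.
rewrite sp pE linearD linearZ /=.
have lw := low _ _ lt sr.
have {h} sn := h n (leq_trans (leq_trans (leq_addr _ _) (leq_addr _ _)) lt).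
have nd : (0 <= n%:Z + d) by rewrite /M in lt; clear -lt; lia.
have small : (size (f (p - p`_n *: 'X^n)%R) < size (f 'X^n)%R)%N.
  by clear -lw sn nd; lia.
by rewrite size_polyDl size_scale.
Qed.

(** Enlarging the threshold past the sizes of all images of low degree makes the
    low part of K[x] map into a low part too. *)
Lemma shifts_window f d : shifts f d -> exists M M' : nat,
  [/\ M'%:Z = M%:Z + d,
      forall p, (size p <= M)%N -> (size (f p) <= M')%N
    & forall p, (M < size p)%N -> (size (f p) + M = size p + M')%N].
Proof.
move=> [N h]; have [B hB] := size_bounded f N.
exists (N + B + `|d|)%N, `|((N + B + `|d|)%N%:Z + d)%R|%N; split=> [|p le|p lt]; first lia.
- by have [/hB|/h] := leqP (size p) N; lia.
- by have := h p; lia.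
Qed.

(** * The index of an eventual shift *)

Section Window.
Variables (f : polyEnd K) (M M' : nat).
Hypothesis f_low : forall p, (size p <= M)%N -> (size (f p) <= M')%N.
Hypothesis f_high :
  forall p, (M < size p)%N -> (size (f p) + M = size p + M')%N.

Let A : 'M[K]_(M, M') := lin1_mx (poly_rV \o f \o rVpoly).

Let mulA (u : 'rV_M) : rVpoly (u *m A) = f (rVpoly u).
Proof. by rewrite mul_rV_lin1 /= poly_rV_K // f_low // size_poly. Qed.

Let size_le p : (size (f p) <= M')%N -> (size p <= M)%N.
Proof. by move=> le; have [//|lt] := leqP (size p) M; have := f_high lt; lia. Qed.

Let sum_rVpoly n m (c : 'I_n -> K) (B : 'M[K]_(n, m)) :
  \sum_i c i *: rVpoly (row i B) = rVpoly ((\row_i c i) *m B).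
Proof.
by rewrite mulmx_sum_row linear_sum; apply: eq_bigr => i _; rewrite mxE linearZ.
Qed.

Let rVpoly_inj n : injective (@rVpoly K n).
Proof. exact: can_inj rVpolyK. Qed.

Let rVpoly_eq0 n (v : 'rV[K]_n) : rVpoly v = 0 -> v = 0.
Proof. by move=> v0; rewrite -[v]rVpolyK v0 linear0. Qed.

Let free_eq0 n m (B : 'M[K]_(n, m)) (c : 'I_n -> K) :
  row_free B -> (\row_i c i) *m B = 0 -> forall i, c i = 0.
Proof.
move=> fB /eqP; rewrite mulmx_free_eq0 // => /eqP/rowP h i.
by have := h i; rewrite !mxE.
Qed.

(** Elements of the kernel have size at most M, so they are the row kernel of the
    matrix of the finite block. *)
Lemma window_ker :
  quo_basis [set p | f p = 0]%classic [set 0]%classic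
    (fun i => rVpoly (row i (row_base (kermx A)))).
Proof.
split=> [i|c|u fu].
- rewrite /= -mulA (_ : _ *m A = 0) ?linear0 //; apply/sub_kermxP.
  by rewrite (submx_trans (row_sub _ _)) // eq_row_base.
- rewrite sum_rVpoly /= => /rVpoly_eq0.
  by apply: free_eq0; rewrite row_base_free.
have su : (size u <= M)%N by apply: size_le; rewrite fu size_poly0.
have : (poly_rV u <= row_base (kermx A))%MS.
  rewrite eq_row_base; apply/sub_kermxP/rVpoly_inj.
  by rewrite mulA poly_rV_K // fu linear0.
case/submxP => D uD; exists (D 0); rewrite /= sum_rVpoly.
rewrite (_ : \row_i _ = D); last by apply/rowP => i; rewrite mxE.
by rewrite -uD poly_rV_K // subrr.
Qed.

(* By successive cancellation of leading terms, the image of f meets every class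
   modulo the polynomials of size at most M'. *)
Let approx q : exists p, (size (q - f p)%R <= M')%N.
Proof.
have [n] := ubnP (size q); elim: n q => // n IH q.
have [le _|lt] := leqP (size q) M'; first by exists 0; rewrite linear0 subr0.
(* k is chosen so that x^k has an image of the same size as q. *)
pose k := (size q + M - M').-1.
rewrite ltnS => qn.
have sk : size (f 'X^k) = size q.
  by have := @f_high 'X^k; rewrite size_polyXn /k; lia.
pose c := lead_coef q / lead_coef (f 'X^k).
have [|p hp] := IH (q - f (c *: 'X^k)).
  apply: (@leq_trans (size q)) => //.
  have q0 : (0 < size q)%N by apply: leq_ltn_trans lt.
  rewrite -[ltnRHS]prednK // ltnS; apply/leq_sizeP => j.
  rewrite linearZ coefB coefZ leq_eqVlt => /orP [/eqP <-|lt'].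
    rewrite -lead_coefE -sk -lead_coefE /c divfK ?subrr //.
    by rewrite lead_coef_eq0 -size_poly_eq0 sk -lt0n.
  have le' : (size q <= j)%N by rewrite -(prednK q0).
  by rewrite !nth_default ?sk // mulr0 subr0.
by exists (c *: 'X^k + p); rewrite linearD opprD addrA.
Qed.

(** A polynomial of size at most M' in the range of f comes from the finite
    block, so a complement of the row space of its matrix spans the cokernel. *)
Lemma window_coker :
  quo_basis setT (range f) (fun i => rVpoly (row i (row_base A^C%MS))).
Proof.
split=> // [c|u _].
- rewrite sum_rVpoly; case=> p _ fp.
  apply: free_eq0; first exact: row_base_free.
  have sp : (size p <= M)%N by apply: size_le; rewrite fp size_poly.
  have E : (\row_i c i) *m row_base A^C%MS = poly_rV p *m A.
    by apply: rVpoly_inj; rewrite mulA poly_rV_K.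
  apply/eqP; rewrite -submx0 -(capmx_compl A) sub_capmx {1}E submxMl /=.
  by rewrite -(eq_row_base A^C%MS) submxMl.
have [p hp] := approx u.
have : (poly_rV (u - f p) <= A + A^C)%MS by rewrite submx_full // addsmx_compl_full.
case/sub_addsmxP => [[v1 v2]] /= E.
have : (v2 *m A^C%MS <= row_base A^C%MS)%MS by rewrite eq_row_base submxMl.
case/submxP => D ED; exists (D 0); rewrite sum_rVpoly.
rewrite (_ : \row_i _ = D); last by apply/rowP => i; rewrite mxE.
have := poly_rV_K hp; rewrite E linearD /= => e.
exists (p + rVpoly v1) => //; rewrite linearD /= -mulA -ED.
by apply/eqP; rewrite eq_sym subr_eq -addrA e addrC subrK.
Qed.

Lemma window_index :
  (quo_dim [set p | f p = 0]%classic [set 0]%classic)%:Z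
    - (quo_dim setT (range f))%:Z = M%:Z - M'%:Z.
Proof.
rewrite (quo_dimE _ window_ker); last first.
  by split=> // c x y /= -> ->; rewrite scaler0 addr0.
rewrite (quo_dimE _ window_coker); last first.
  split; first by exists 0; rewrite ?linear0.
  by move=> c _ _ [p _ <-] [q _ <-]; exists (c *: p + q); rewrite // linearP.
rewrite mxrank_ker mxrank_compl.
have := rank_leq_row A; have := rank_leq_col A; lia.
Qed.

End Window.

Lemma ind_shifts (a : I1 K) d : shifts (\val a) d -> ind a = - d.
Proof.
case/shifts_window => M [M' [e lo hi]].
by rewrite /ind (window_index lo hi) e; lia.
Qed.

End Shifts.

(** * The degree in B_1 as an eventual shift *)

Section Degree.
Variable K : fieldType.

Lemma bigmax_head (s : seq int) : s != [::] ->
  \big[Num.max/head 0 s]_(x <- s) x \in s /\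
  forall y, y \in s -> y <= \big[Num.max/head 0 s]_(x <- s) x.
Proof.
move=> s0; split; last first.
  by move=> y ys; exact: (le_bigmax_seq _ y xpredT id ys).
have : \big[Num.max/head 0 s]_(x <- s) x \in head 0 s :: s.
  move: (head 0 s) => x0; elim: (s) => [|x r IH]; rewrite ?big_nil ?mem_head //.
  rewrite big_cons maxElt; case: ifP => _; last by rewrite !inE eqxx orbT.
  by move: IH; rewrite !inE => /orP [->|->]; rewrite ?orbT.
by case: s s0 => //= x s _; rewrite inE => /orP [/eqP -> |//]; rewrite mem_head.
Qed.

(** In terms of powers of d rather than of its inverse, the degree is read off
    the lowest exponent. *)
Lemma deg_dinvP (u : B1 K) : u != 0 -> exists k : int,
  [/\ deg_dinv u = - k, u@_k != 0 & forall l, u@_l != 0 -> k <= l].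
Proof.
move=> u0; rewrite /deg_dinv; set s := [seq - k | k <- msupp u].
have s0 : s != [::].
  apply: contraNneq u0 => /(congr1 size); rewrite size_map => e.
  apply/eqP/malgP => k; rewrite mcoeff0 mcoeff_outdom //.
  have : (enum_fset (msupp u)) = [::] by apply: size0nil.
  by move=> e'; rewrite -[k \in _]/(k \in enum_fset (msupp u)) e'.
have [/mapP [k ks e] hmax] := bigmax_head s0.
exists k; split=> //; first by rewrite mcoeff_neq0.
move=> l; rewrite mcoeff_neq0 => ls; have := hmax (- l).
by rewrite e lerN2; apply; apply/mapP; exists l.
Qed.

Hypothesis K0 : [pchar K] =i pred0.

Lemma natr_inj_char0 : injective (fun n : nat => n%:R : K).
Proof.
have lt_neq (m l : nat) : (m < l)%N -> m%:R != l%:R :> K.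
  move=> lt; rewrite eq_sym -subr_eq0 -natrB ?(ltnW lt) //.
  by rewrite ((pcharf0P K).1 K0) -lt0n subn_gt0.
by move=> m l /= /eqP; case: (ltngtP m l) => // [/lt_neq|/lt_neq]; [|rewrite eq_sym]; move/negbTE->.
Qed.

(** In characteristic zero the natural numbers are distinct, so only finitely
    many of them are roots. *)
Lemma horner_nat_neq0 (c : {poly K}) : c != 0 ->
  exists N, forall n, (N <= n)%N -> c.[n%:R] != 0.
Proof.
have [m] := ubnP (size c); elim: m c => // m IH c; rewrite ltnS => sc c0.
have [[n /eqP rn]|h] := pselect (exists n : nat, c.[n%:R] = 0); last first.
  by exists 0%N => n _; apply/eqP => e; apply: h; exists n.
have /factor_theorem [q cE] : root c n%:R by [].
have q0 : q != 0 by apply: contraNneq c0 => q0; rewrite cE q0 mul0r.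
have [|N hN] := IH q _ q0.
  by apply: leq_trans sc; rewrite cE size_Mmonic ?monicXsubC // size_XsubC addn2.
exists (maxn N n.+1) => l; rewrite geq_max => /andP [/hN ql nl].
rewrite cE hornerM mulf_neq0 // hornerXsubC subr_eq0.
by apply: contraTneq nl => /natr_inj_char0 ->; rewrite ltnn.
Qed.

Lemma fact_neq0 n : n`!%:R != 0 :> K.
Proof. by rewrite ((pcharf0P K).1 K0) -lt0n fact_gt0. Qed.

Lemma size_dpow (n : nat) : size (dpow K n) = n.+1.
Proof. by rewrite dpowE size_scale ?size_polyXn // invr_eq0 fact_neq0. Qed.

(** With k the lowest exponent of d in u, the summand of index k of the action on
    x^n/n! is a multiple of x^(n-k)/(n-k)! and all others have lower degree; the
    multiple is a value of a nonzero polynomial at an integer, hence nonzero for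
    n large. *)
Lemma asym_shifts f (u : B1 K) : u != 0 -> asym f u -> shifts f (deg_dinv u).
Proof.
move=> /deg_dinvP [k [-> uk umin]] [N hN].
have tu : tau (1 - k) u@_k != 0.
  by apply: contraNneq uk => e; rewrite -[u@_k]tau0 -(subrr (1 - k)) addrC -tauD e rmorph0.
have [N' hN'] := horner_nat_neq0 tu.
apply: (@shifts_of_Xn _ _ _ (N + N' + `|k|)%N) => n le.
have -> : size (f 'X^n) = size (f (dpow K n)).
  by rewrite dpowE linearZ size_scale // invr_eq0 fact_neq0.
rewrite hN; last by lia.
rewrite /B1act (big_fsetD1 k) -?mcoeff_neq0 //=.
have [m mE] : exists m : nat, n%:Z - k = m.
  by exists `|n%:Z - k|%N; lia.
have c0 : (u@_k).[(n%:Z - k + 1)%:~R] != 0.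
  have -> : n%:Z - k + 1 = n%:Z + (1 - k) by lia.
  by rewrite intrD -horner_tau; apply: hN'; lia.
have lt l : l \in (msupp u `\ k)%fset -> (size (dpow K (n%:Z - l)) <= m)%N.
  rewrite in_fsetD1 -mcoeff_neq0 => /andP [lk /umin kl].
  case E : (n%:Z - l) => [j|j]; last by rewrite dpowN size_poly0.
  by rewrite size_dpow; move/eqP: lk; lia.
rewrite size_polyDl size_scale // mE size_dpow; first by lia.
rewrite ltnS; apply: (leq_trans (size_sum _ _ _)).
apply/bigmax_leqP_seq => l ls _; apply: (leq_trans (size_scale_leq _ _)); exact: lt.
Qed.

End Degree.

(** * The index is a valuation on I_1 outside F *)

Section Index.
Variables (K : fieldType) (K0 : [pchar K] =i pred0).
Implicit Types a b : I1 K.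

Lemma toB1_neq0 a : (toB1 K0 a != 0) = (a \notin I1F).
Proof. by rewrite toB1_eq0. Qed.

Lemma shifts_deg a : a \notin I1F -> shifts (\val a) (deg_dinv (toB1 K0 a)).
Proof. by rewrite -toB1_neq0 => a0; apply: asym_shifts => //; exact: toB1P. Qed.

Lemma ind_deg a : a \notin I1F -> ind a = - deg_dinv (toB1 K0 a).
Proof. by move=> /shifts_deg /ind_shifts. Qed.

Lemma shifts_ind a : a \notin I1F -> shifts (\val a) (- ind a).
Proof. by move=> aF; rewrite (ind_deg aF) opprK; exact: shifts_deg. Qed.

(** Elements of F kill x^n for n large. *)
Lemma shifts_notinF a d : shifts (\val a) d -> a \notin I1F.
Proof.
move=> [M h]; apply/negP => /(I1F_dpowP K0) [N hN].
pose n := (M + N + `|d|)%N; have := h (dpow K n).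
rewrite size_dpow // hN; last by rewrite /n; lia.
by rewrite size_poly0 /n; lia.
Qed.

Lemma mul_notinF a b : a \notin I1F -> b \notin I1F -> a * b \notin I1F.
Proof.
move=> /shifts_ind ha /shifts_ind hb.
exact: (@shifts_notinF (a * b) _ (shifts_comp ha hb)).
Qed.

Lemma indM a b : a \notin I1F -> b \notin I1F -> ind (a * b) = ind a + ind b.
Proof.
move=> /shifts_ind ha /shifts_ind hb.
by rewrite (@ind_shifts _ (a * b) _ (shifts_comp ha hb)) opprD !opprK.
Qed.

Lemma ind_add_ge a b : a \notin I1F -> b \notin I1F -> a + b \notin I1F ->
  Num.min (ind a) (ind b) <= ind (a + b).
Proof.
move=> /shifts_ind ha /shifts_ind hb /shifts_ind hab.
by have := shifts_add_le ha hb hab erefl; lia.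
Qed.

Lemma shifts_dpow (k : int) : shifts (\val (I1dpow K k)) (- k).
Proof.
apply: (@shifts_of_Xn _ _ _ `|k|%N) => n le.
have -> : size (\val (I1dpow K k) 'X^n) = size (\val (I1dpow K k) (dpow K n)).
  by rewrite dpowE linearZ size_scale // invr_eq0 fact_neq0.
rewrite (I1dpow_dpow K0) (_ : n%:Z - k = `|n%:Z - k|%N); last by lia.
by rewrite size_dpow //; lia.
Qed.

Lemma I1dpow_notinF k : I1dpow K k \notin I1F.
Proof. exact: shifts_notinF (shifts_dpow k). Qed.

Lemma ind_dpow k : ind (I1dpow K k) = k.
Proof. by rewrite (ind_shifts (shifts_dpow k)) opprK. Qed.

Lemma d_int : I1d K * I1int K = 1.
Proof.
apply/val_inj/(polyEnd_dpow K0) => n.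
rewrite [LHS](_ : _ = derivX K (intX K (dpow K n))) // int_dpow // deriv_dpow //.
by rewrite addrK.
Qed.

Lemma dX_intX n : I1d K ^+ n * I1int K ^+ n = 1.
Proof.
elim: n => [|n IH]; first by rewrite !expr0 mulr1.
by rewrite exprSr exprS mulrA -[X in X * _]mulrA d_int mulr1 IH.
Qed.

End Index.

(** * Extension of a valuation to the skew field of left fractions *)

Section FractionValuation.
Variables (R : nzRingType) (D : unitRingType) (f : {rmorphism R -> D}).
Hypothesis fracD : is_skew_field_of_fractions f.
Variable w : R -> int.
Implicit Types (s t u x y : R) (p q : D).
Hypothesis wM : forall u t, u != 0 -> t != 0 -> w (u * t) = w u + w t.
Hypothesis wD : forall u t, u != 0 -> t != 0 -> u + t != 0 ->
  Num.min (w u) (w t) <= w (u + t).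
Hypothesis w_surj : forall n, exists2 u, u != 0 & w u = n.

Let f_inj : injective f. Proof. by case: fracD. Qed.

Let f_eq0 u : (f u == 0) = (u == 0).
Proof. by rewrite -(inj_eq f_inj) rmorph0. Qed.

Let f_unit u : u != 0 -> f u \is a GRing.unit.
Proof. by have [unitD _ _] := fracD; rewrite -f_eq0; exact: unitD. Qed.

Let mul_neq0 u t : u != 0 -> t != 0 -> u * t != 0.
Proof.
move=> u0 t0; rewrite -f_eq0 rmorphM /=; apply: contraTneq (f_unit t0) => e.
by rewrite -(mulKr (f_unit u0) (f t)) e mulr0 unitr0.
Qed.

(* Rewriting the right fraction u s^-1 as a left one yields the Ore condition. *)
Let ore u s : s != 0 ->
  exists x y, [/\ x != 0, x * u = y * s & (u != 0 -> y != 0)].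
Proof.
move=> s0; have [_ _ frac] := fracD.
have [x [y [x0 e]]] := frac (f u * (f s)^-1).
have E : x * u = y * s.
  apply: f_inj; rewrite !rmorphM /=.
  by rewrite -(mulVKr (f_unit x0) (f y)) -e -!mulrA mulVr ?f_unit // mulr1.
exists x, y; split=> // u0; apply: contraTneq (mul_neq0 x0 u0) => y0.
by rewrite E y0 mul0r eqxx.
Qed.

Let fracP q : q != 0 -> exists s u, [/\ s != 0, u != 0 & q = (f s)^-1 * f u].
Proof.
have [_ _ frac] := fracD; have [s [u [s0 ->]]] := frac q => q0.
by exists s, u; split=> //; apply: contraNneq q0 => ->; rewrite rmorph0 mulr0.
Qed.

Let frac_mul s u q : s != 0 -> q = (f s)^-1 * f u -> f u = f s * q.
Proof. by move=> s0 ->; rewrite mulVKr ?f_unit. Qed.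

Let frac_of s u q : s != 0 -> f u = f s * q -> q = (f s)^-1 * f u.
Proof. by move=> s0 ->; rewrite mulKr ?f_unit. Qed.

Let frac_uniq s u s' u' q : s != 0 -> u != 0 -> s' != 0 -> u' != 0 ->
  q = (f s)^-1 * f u -> q = (f s')^-1 * f u' -> w u - w s = w u' - w s'.
Proof.
move=> s0 u0 s0' u0' /(frac_mul s0) e /(frac_mul s0') e'.
have [x [y [x0 xy /(_ s0) y0]]] := ore s s0'.
have E : x * u = y * u'.
  by apply: f_inj; rewrite !rmorphM /= e e' !mulrA -!rmorphM xy.
by move: (congr1 w E) (congr1 w xy); rewrite !wM //; lia.
Qed.

(* A relation rather than a function: a fraction has many representations, and
   frac_uniq shows that they all give the same value. *)
Let frac_val q (z : Zinf) := (q = 0 /\ z = None) \/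
  exists s u, [/\ s != 0, u != 0, q = (f s)^-1 * f u & z = Some (w u - w s)].

Definition fraction_valuation q : Zinf := xget None [set z | frac_val q z]%classic.
Local Notation v := fraction_valuation.

Let frac_neq0 s u : s != 0 -> u != 0 -> (f s)^-1 * f u != 0.
Proof.
move=> s0 u0; apply: contraNneq u0 => /esym /(frac_mul s0).
by rewrite mulr0 => /eqP; rewrite f_eq0.
Qed.

Lemma fraction_valuation0 : v 0 = None.
Proof.
rewrite /v; case: xgetP => // z _ [[_ ->] //|[s [u [s0 u0 /esym/eqP]]]].
by rewrite (negbTE (frac_neq0 s0 u0)).
Qed.

Lemma fraction_valuationE s u q : s != 0 -> u != 0 -> q = (f s)^-1 * f u ->
  v q = Some (w u - w s).
Proof.
move=> s0 u0 e; have q0 : q != 0 by rewrite e frac_neq0.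
rewrite /v; case: xgetP => [z _ [[/eqP]|[s' [u' [s0' u0' e' ->]]]]|h].
- by rewrite (negbTE q0).
- by rewrite (frac_uniq s0 u0 s0' u0' e e').
- by case: (h (Some (w u - w s))); right; exists s, u.
Qed.

Lemma fraction_valuation_discrete : discrete_valuation v.
Proof.
have v0 := fraction_valuation0; split.
- move=> q; split=> [vq|->//]; apply/eqP/negPn/negP => /fracP [s [u [s0 u0 e]]].
  by rewrite (fraction_valuationE s0 u0 e) in vq.
- move=> p q; have [->|p0] := eqVneq p 0; first by rewrite mul0r v0.
  have [->|q0] := eqVneq q 0; first by rewrite mulr0 v0; case: (v p).
  have [s [u [s0 u0 ep]]] := fracP p0; have [t [r [t0 r0 eq]]] := fracP q0.
  have [x [y [x0 xy /(_ u0) y0]]] := ore u t0.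
  rewrite (fraction_valuationE s0 u0 ep) (fraction_valuationE t0 r0 eq) /=.
  (* With x u = y t one has s^-1 u t^-1 r = (x s)^-1 (y r). *)
  rewrite (@fraction_valuationE (x * s) (y * r)) ?mul_neq0 //; last first.
    apply: frac_of; first exact: mul_neq0.
    rewrite !rmorphM /= (frac_mul t0 eq) mulrA -rmorphM -xy rmorphM /=.
    by rewrite (frac_mul s0 ep) !mulrA.
  by move: (congr1 w xy); rewrite !wM // => e; congr Some; lia.
- move=> p q; have [->|p0] := eqVneq p 0.
    by rewrite v0 add0r /minZinf; case: (v q) => [m|] //=.
  have [->|q0] := eqVneq q 0.
    by rewrite v0 addr0 /minZinf; case: (v p) => [m|] //=.
  have [->|pq0] := eqVneq (p + q) 0; first by rewrite v0.
  have [s [u [s0 u0 ep]]] := fracP p0; have [t [r [t0 r0 eq]]] := fracP q0.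
  have [x [y [x0 xy /(_ s0) y0]]] := ore s t0.
  (* Over the common denominator x s = y t the sum is (x s)^-1 (x u + y r). *)
  have [z zE] : exists z, z = x * u + y * r by eexists.
  have xs0 := mul_neq0 x0 s0.
  have epq : f z = f (x * s) * (p + q).
    rewrite zE rmorphD !rmorphM /= (frac_mul s0 ep) (frac_mul t0 eq) mulrDr.
    by rewrite !mulrA -!rmorphM xy.
  have z0 : z != 0.
    rewrite -f_eq0 epq; apply: contraNneq pq0 => e.
    by rewrite -(mulKr (f_unit xs0) (p + q)) e mulr0.
  have wz : Num.min (w (x * u)) (w (y * r)) <= w z.
    by rewrite zE; apply: wD; rewrite ?mul_neq0 // -zE.
  rewrite (fraction_valuationE s0 u0 ep) (fraction_valuationE t0 r0 eq).
  rewrite (fraction_valuationE xs0 z0 (frac_of xs0 epq)).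
  move: (congr1 w xy) wz; rewrite !wM // /minZinf /=.
  by case: ifP => /=; lia.
- move=> n; have [u u0 wu] := w_surj n; exists (f u).
  rewrite (@fraction_valuationE 1 u) ?oner_neq0 //; last by rewrite rmorph1 invr1 mul1r.
  have := wM (oner_neq0 R) (oner_neq0 R).
  by rewrite mulr1 => /esym/(canRL (addrK _)); rewrite subrr => ->; rewrite wu subr0.
Qed.

End FractionValuation.

(** * B_1 and A_1 have the same fractions *)

Section WeylFractions.
Variables (K : fieldType) (K0 : [pchar K] =i pred0).

Let weyl_x : A1 K := MkA1 (@gen_subalg_sub K (I1 K) _ _ (or_introl erefl)).
Let weyl_d : A1 K := MkA1 (@gen_subalg_sub K (I1 K) _ _ (or_intror erefl)).

(** With H = d x, the monomial c(H) d^m is a word in x and d. *)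
Lemma weyl_monomial (c : {poly K}) (m : nat) :
  exists y : A1 K, toB1 K0 (\val y) = << c *g m%:Z >>.
Proof.
pose W := weyl_d * weyl_x.
have hH (p : {poly K}) : exists y : A1 K, \val y = horner_alg (I1H K) p.
  elim/poly_ind: p => [|p b [y IH]]; first by exists 0; rewrite !rmorph0.
  exists (y * W + b *: 1); rewrite rmorphD rmorphM /= IH.
  by rewrite rmorphD rmorphM /= horner_algX horner_algC.
have [y ye] := hH c; exists (y * weyl_d ^+ m).
have -> : \val (y * weyl_d ^+ m) = horner_alg (I1H K) c * I1d K ^+ m.
  by rewrite rmorphM rmorphXn /= ye.
apply: toB1E; exists 0%N => n _.
by rewrite B1actU -(alg_eval_dpow K0) -(derivX_dpow K0) rmorphM rmorphXn.
Qed.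

(** Left multiplication by a high power of d clears the negative powers of d. The
    bound is uniform above n so that sums can be treated summand by summand. *)
Lemma weyl_localization (u : B1 K) : exists n : nat, forall m : nat, (n <= m)%N ->
  exists y : A1 K, toB1 K0 (\val y) = B1d K m%:Z * u.
Proof.
elim/B1_ind: u => [|u v [n hn] [m hm]|c k].
- by exists 0%N => m _; exists 0; rewrite !rmorph0 mulr0.
- exists (maxn n m) => l; rewrite geq_max => /andP [/hn [y ye] /hm [z ze]].
  by exists (y + z); rewrite mulrDr -ye -ze !rmorphD.
exists `|k|%N => m le; have [y ye] := weyl_monomial (tau m%:Z c) `|(m%:Z + k)%R|%N.
exists y; rewrite ye /B1d B1MUU mul1r; congr << _ *g _ >>; lia.
Qed.

(** Only the injectivity of f has content: if f u = 0, then d^n u comes from an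
    element of A_1 that maps to 0 in D. *)
Lemma fractions_of_B1 (D : unitRingType) (f : {rmorphism B1 K -> D}) :
  is_skew_field_of_fractions (f \o toB1 K0 \o (\val : A1 K -> I1 K)) ->
  is_skew_field_of_fractions f.
Proof.
move=> [unitD inj frac]; split=> //.
- apply: raddf_inj => u fu.
  have [n /(_ n (leqnn n)) [y ye]] := weyl_localization u.
  have y0 : y = 0 by apply: inj; rewrite rmorph0 /= ye rmorphM /= fu mulr0.
  have dK : B1d K (- n%:Z) * B1d K n%:Z = 1.
    by rewrite /B1d B1MUU rmorph1 mulr1 addNr.
  by rewrite -[u]mul1r -dK -mulrA -ye y0 !rmorph0 mulr0.
- move=> q; have [s [u [s0 ->]]] := frac q.
  exists (toB1 K0 (\val s)), (toB1 K0 (\val u)); split=> //.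
  apply: contraNneq s0 => e; apply/eqP/inj.
  by rewrite rmorph0 /= e rmorph0.
Qed.

(** The index factors through B_1 as the opposite of the degree, and its
    valuation properties descend from I_1 along the surjection onto B_1. *)
Lemma index_valuation (D : unitRingType) (f : {rmorphism B1 K -> D}) :
  is_skew_field_of_fractions (f \o toB1 K0 \o (\val : A1 K -> I1 K)) ->
  exists v : D -> Zinf, is_index_extension K0 f v /\ discrete_valuation v.
Proof.
move=> /fractions_of_B1 fracD.
pose w (u : B1 K) := - deg_dinv u.
have wE (a : I1 K) : a \notin I1F -> w (toB1 K0 a) = ind a.
  by move=> aF; rewrite (ind_deg K0).
have lift (u : B1 K) : u != 0 -> exists2 a : I1 K, a \notin I1F & toB1 K0 a = u.
  by have [a <-] := toB1_surj K0 u; rewrite toB1_neq0; exists a.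
have wM (u t : B1 K) : u != 0 -> t != 0 -> w (u * t) = w u + w t.
  move=> /lift [a aF <-] /lift [b bF <-].
  by rewrite -rmorphM !wE ?indM ?(mul_notinF K0).
have wD (u t : B1 K) : u != 0 -> t != 0 -> u + t != 0 ->
    Num.min (w u) (w t) <= w (u + t).
  move=> /lift [a aF <-] /lift [b bF <-]; rewrite -rmorphD toB1_neq0 => abF.
  by rewrite !wE // (ind_add_ge K0).
have w_surj n : exists2 u : B1 K, u != 0 & w u = n.
  by exists (toB1 K0 (I1dpow K n)); rewrite ?toB1_neq0 ?wE ?I1dpow_notinF ?(ind_dpow K0).
exists (fraction_valuation f w); split; last exact: fraction_valuation_discrete.
split; first exact: fraction_valuation0.
move=> s u sF uF; rewrite -!wE //.
by apply: fraction_valuationE; rewrite ?toB1_neq0.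
Qed.

End WeylFractions.

(** * Invariance under automorphisms *)

Section Automorphisms.
Variables (K : fieldType) (K0 : [pchar K] =i pred0).

Let mulpoly (q : {poly K}) : I1 K := horner_alg (I1x K) q.

Lemma mulpoly1 q : \val (mulpoly q) 1 = q.
Proof.
rewrite /mulpoly; elim/poly_ind: q => [|p c IH]; first by rewrite rmorph0.
rewrite rmorphD mulrC rmorphM /= horner_algX horner_algC.
rewrite [LHS](_ : _ = 'X * \val (horner_alg (I1x K) p) 1 + c *: 1) // IH mulrC.
by rewrite alg_polyC.
Qed.

(** Differentiating p as often as its degree leaves a nonzero constant. *)
Lemma reach_one (p : {poly K}) : p != 0 -> exists c : I1 K, \val c p = 1.
Proof.
move=> p0; pose n := (size p).-1.
have [k k0 kE] : exists2 k, k != 0 & \val (I1d K ^+ n) p = k%:P.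
  exists (lead_coef p * n`!%:R); first by rewrite mulf_neq0 ?lead_coef_eq0 ?fact_neq0.
  have -> : \val (I1d K ^+ n) p = p^`(n).
    by rewrite valX; elim: n => [|n IH] //; rewrite exprS polyEndME IH derivnS.
  apply/polyP => i; rewrite coef_derivn coefC; case: i => [|i] /=.
    by rewrite addn0 ffactnn lead_coefE mulr_natr.
  by rewrite nth_default ?mul0rn // addnS (leq_trans (leqSpred _)) // ltnS leq_addr.
exists (k^-1 *: I1d K ^+ n); rewrite [LHS](_ : _ = k^-1 *: \val (I1d K ^+ n) p) //.
by rewrite kE -mul_polyC -polyCM mulVf.
Qed.

(** Hence K[x] is a simple I_1-module. *)
Lemma reach (p q : {poly K}) : p != 0 -> exists c : I1 K, \val c p = q.
Proof.
move=> /reach_one [c cp]; exists (mulpoly q * c).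
by rewrite [LHS](_ : _ = \val (mulpoly q) (\val c p)) // cp mulpoly1.
Qed.

(** e_00 is the projection onto the constants, so a e_00 only depends on a 1. *)
Lemma e00_mul_eq0 (a : I1 K) : \val a 1 = 0 -> a * I1e K 0 0 = 0.
Proof.
move=> a1; apply/val_inj/(polyEnd_dpow K0) => n.
rewrite [LHS](_ : _ = \val a (\val (I1e K 0 0) (dpow K n))) // I1e_dpow //.
case: eqP => _; last by rewrite linear0.
by rewrite dpowE expr0 linearZ /= a1 scaler0.
Qed.

Lemma e00_neq0 : I1e K 0 0 != 0.
Proof.
apply/eqP => /(congr1 (fun b : I1 K => \val b (dpow K 0))); rewrite I1e_dpow //=.
by move/eqP; rewrite -size_poly_eq0 size_dpow.
Qed.

(** The map r |-> sigma(r(x)) p, with p nonzero in the image of sigma(e_00),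
    intertwines the action with its twist by sigma: a 1 = 0 gives a e_00 = 0, so
    sigma(a) p = 0.  It is bijective by simplicity of K[x]. *)
Lemma automorphism_intertwiner (sigma : {lrmorphism I1 K -> I1 K}) :
  bijective sigma -> exists phi : polyEnd K,
    [/\ injective phi, forall y, exists x, phi x = y
      & forall (a : I1 K) p, phi (\val a p) = \val (sigma a) (phi p)].
Proof.
move=> [sigmaV sigmaK sigmaVK]; pose g := sigma (I1e K 0 0).
have [q gq] : exists q, \val g q != 0.
  apply: contrapT => h; have /eqP[] := e00_neq0; apply: (can_inj sigmaK).
  rewrite rmorph0; apply/val_inj/polyEndP => q.
  by apply/eqP/negPn/negP => n0; apply: h; exists q.
pose p := \val g q.
have kill (a : I1 K) : \val a 1 = 0 -> \val (sigma a) p = 0.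
  move=> /e00_mul_eq0 /(congr1 sigma); rewrite rmorphM rmorph0 => e.
  by rewrite /p -polyEndME -[_ * _]/(\val (sigma (a : I1 K) * g)) e.
have phi_lin : linear (fun r => \val (sigma (mulpoly r)) p).
  move=> c r t; rewrite /mulpoly rmorphD -mul_polyC rmorphM /= horner_algC.
  by rewrite mulr_algl linearP.
pose phi := mkEnd phi_lin.
have phiE (a : I1 K) r : phi (\val a r) = \val (sigma a) (phi r).
  apply/eqP; rewrite -subr_eq0; apply/eqP.
  rewrite -[RHS](kill (mulpoly (\val a r) - a * mulpoly r)).
    by rewrite rmorphB rmorphM.
  rewrite -[LHS]/(\val (mulpoly (\val a r)) 1 - \val a (\val (mulpoly r) 1)).
  by rewrite !mulpoly1 subrr.
have phi1 : phi 1 = p by rewrite /= /mulpoly !rmorph1.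
exists phi; split=> //.
- apply: raddf_inj => r /eqP phir; apply/eqP; apply: contraTT phir.
  move=> /reach_one [c cr]; apply: contraNneq gq => e.
  by rewrite -/p -phi1 -cr phiE e linear0.
move=> y; have [b by_] := reach y gq.
by exists (\val (sigmaV b) 1); rewrite phiE phi1 sigmaVK.
Qed.

Lemma ind_automorphism (sigma : {lrmorphism I1 K -> I1 K}) (a : I1 K) :
  bijective sigma -> ind (sigma a) = ind a.
Proof.
move=> /automorphism_intertwiner [phi [phi_inj phi_surj phiE]].
have phi0 x : x = 0 <-> phi x = 0.
  by split=> [->|e]; [|apply: phi_inj; rewrite e]; rewrite linear0.
rewrite /ind; congr (Posz _ - Posz _); apply/esym.
  apply: (quo_dim_transport (phi := phi)) => // x /=.
  by rewrite -phiE; exact: phi0.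
apply: (quo_dim_transport (phi := phi)) => // x; split=> [[y _ <-]|[z _ e]].
  by exists (phi y) => //; apply/esym/phiE.
have [y yE] := phi_surj z; exists y => //; apply: phi_inj.
by apply: etrans (phiE a y) _; rewrite [phi y]yE.
Qed.

End Automorphisms.

(** * Splitting off powers of d and of the integration *)

Section Factorization.
Variables (K : fieldType) (K0 : [pchar K] =i pred0).
Implicit Types a : I1 K.

Lemma I1dpowN n : I1dpow K (- n%:Z) = I1int K ^+ n.
Proof. by case: n => [|n]; rewrite ?oppr0 // -NegzE. Qed.

Lemma factor_dX a n : a \notin I1F -> ind a = n%:Z -> exists a' : I1 K,
  [/\ a' \notin I1F, ind a' = 0 & a = I1d K ^+ n * a'].
Proof.
move=> aF ia; exists (I1int K ^+ n * a); rewrite -I1dpowN; split.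
- exact: mul_notinF (I1dpow_notinF K0 _) aF.
- by rewrite indM ?I1dpow_notinF // ind_dpow // ia addNr.
- by rewrite I1dpowN mulrA dX_intX // mul1r.
Qed.

Lemma factor_intX a n : a \notin I1F -> ind a = - n%:Z -> exists a' : I1 K,
  [/\ a' \notin I1F, ind a' = 0 & a = a' * I1int K ^+ n].
Proof.
move=> aF ia; exists (a * I1dpow K n); split.
- exact: mul_notinF aF (I1dpow_notinF K0 _).
- by rewrite indM ?I1dpow_notinF // ind_dpow // ia addNr.
- by rewrite -mulrA dX_intX // mulr1.
Qed.

Lemma ind_dX_mul a n : a \notin I1F -> ind (I1d K ^+ n * a) = n%:Z + ind a.
Proof.
by move=> aF; rewrite -[_ ^+ n]/(I1dpow K n) indM ?I1dpow_notinF // ind_dpow.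
Qed.

Lemma ind_mul_intX a n : a \notin I1F -> ind (a * I1int K ^+ n) = ind a - n%:Z.
Proof. by move=> aF; rewrite -I1dpowN indM ?I1dpow_notinF // ind_dpow. Qed.

End Factorization.

Theorem proposition6p1 (K : fieldType) (K0 : [pchar K] =i pred0)
    (a : I1 K) (aF : a \notin I1F) :
  [/\ ind a = - deg_dinv (toB1 K0 a),
      (0 <= ind a <->
         exists a' : I1 K,
           [/\ a' \notin I1F, ind a' = 0 & a = I1d K ^+ `|ind a|%N * a'])
      /\ (ind a <= 0 <->
         exists a' : I1 K,
           [/\ a' \notin I1F, ind a' = 0 & a = a' * I1int K ^+ `|ind a|%N]),
      (forall b : I1 K, b \notin I1F -> a + b \notin I1F ->
         Num.min (ind a) (ind b) <= ind (a + b))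
      /\ (forall (D : unitRingType) (f : {rmorphism B1 K -> D}),
            is_skew_field_of_fractions (f \o toB1 K0 \o (\val : A1 K -> I1 K)) ->
            exists v : D -> Zinf,
              is_index_extension K0 f v /\ discrete_valuation v)
    & forall sigma : {lrmorphism I1 K -> I1 K}, bijective sigma ->
        ind (sigma a) = ind a].
Proof.
split.
- exact: ind_deg.
- split; split=> [ia|[a' [a'F ia' aE]]].
  + by apply: (factor_dX K0) => //; rewrite gez0_abs.
  + by rewrite aE ind_dX_mul // ia' addr0.
  + by apply: (factor_intX K0) => //; rewrite lez0_abs // opprK.
  + by rewrite aE ind_mul_intX // ia' sub0r oppr_le0.
- by split=> [b bF abF|D f]; [exact: (ind_add_ge K0)|exact: index_valuation].
- by move=> sigma; exact: ind_automorphism.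
Qed.
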